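(* Let $(G_i): 0\to N_i\xrightarrow{\chi_i} G_i\xrightarrow{\pi_i} Q_i\to 0$, $i=1,2$, be central extensions of algebras with bracket. The following statements are equivalent: (a) The central extensions $(G_1)$ and $(G_2)$ are isoclinic. (b) There exists a central extension $(G'): 0\to N'\to G'\to Q'\to 0$ together with isoclinic epimorphisms from $(G')$ onto $(G_1)$ and onto $(G_2)$. In particular, $G'$ contains two-sided ideals $G'_1,G'_2$ such that $G_1\cong G'/G'_1\sim G'\sim G'/G'_2\cong G_2$. (c) There exists a central extension $(G''): 0\to N''\to G''\to Q''\to 0$ together with isoclinic monomorphisms from $(G_1)$ and from $(G_2)$ into $(G'')$. In particular, $G''$ contains subalgebras $G''_1,G''_2$ such that $G_1\cong G''_1\sim G''\sim G''_2\cong G_2$.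
   Context: Fix a ground field $\mathbb{K}$. An algebra with bracket (AWB) is an associative (not necessarily commutative, not necessarily unital) $\mathbb{K}$-algebra $A$ with a bilinear map $[-,-]:A\times A\to A$ satisfying $[ab,c]=[a,c]b+a[b,c]$ for all $a,b,c\in A$. Homomorphisms of AWB's are $\mathbb{K}$-linear maps preserving product and bracket. A subalgebra is a subspace closed under product and bracket; a two-sided ideal of $A$ is a subspace $I$ with $AI,IA,[A,I],[I,A]\subseteq I$. $[[A,A]]$ denotes the two-sided ideal of $A$ spanned by all $ab$ and $[a,b]$, $a,b\in A$. The center is $Z(A)=\{a\in A: ab=ba=0,\ [a,b]=[b,a]=0\ \forall b\in A\}$. A central extension $(G): 0\to N\xrightarrow{\chi}G\xrightarrow{\pi}Q\to 0$ is a short exact sequence of AWB's with $\chi(N)\subseteq Z(G)$. Its commutator maps $C,P:Q\times Q\to[[G,G]]$ are $C(q_1,q_2)=[g_1,g_2]$ and $P(q_1,q_2)=g_1g_2$, where $\pi(g_j)=q_j$. For central extensions $(G_1),(G_2)$ with commutator maps $C_i,P_i$, an isoclinism from $(G_1)$ to $(G_2)$ is a pair $(\eta,\xi)$ of AWB isomorphisms $\eta:Q_1\to Q_2$, $\xi:[[G_1,G_1]]\to[[G_2,G_2]]$ with $\xi(C_1(q,q'))=C_2(\eta(q),\eta(q'))$ and $\xi(P_1(q,q'))=P_2(\eta(q),\eta(q'))$ for all $q,q'\in Q_1$; the extensions are isoclinic if one exists. Two AWB's $A,B$ are isoclinic, written $A\sim B$, if the central extensions $0\to Z(A)\to A\to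 A/Z(A)\to0$ and $0\to Z(B)\to B\to B/Z(B)\to 0$ are isoclinic. A homomorphism of extensions $(G_1)\to(G_2)$ is a triple $(\alpha,\beta,\gamma)$ of AWB homomorphisms $\alpha:N_1\to N_2$, $\beta:G_1\to G_2$, $\gamma:Q_1\to Q_2$ with $\beta\chi_1=\chi_2\alpha$, $\gamma\pi_1=\pi_2\beta$. It is isoclinic if there is an isomorphism $\beta':[[G_1,G_1]]\to[[G_2,G_2]]$ such that $(\gamma,\beta')$ is an isoclinism from $(G_1)$ to $(G_2)$; it is an isoclinic epimorphism (resp. monomorphism) if in addition $\beta$ is surjective (resp. injective). *)

(* Defs.v *)
From HB Require Import structures.
From mathcomp Require Import all_boot all_order all_algebra.
From mathcomp Require Import ring_quotient sesquilinear boolp.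

Set Implicit Arguments.
Unset Strict Implicit.
Unset Printing Implicit Defensive.

Import GRing.Theory.

Local Open Scope ring_scope.
Local Open Scope quotient_scope.

HB.mixin Record Lmodule_isAWB (K : fieldType) A of GRing.Lmodule K A := {
  amul : A -> A -> A;
  abr : A -> A -> A;
  amul_bilinear : bilinear_for *:%R *:%R amul;
  abr_bilinear : bilinear_for *:%R *:%R abr;
  amulA : associative amul;
  abr_amul : forall a b c,
    abr (amul a b) c = amul (abr a c) b + amul a (abr b c)
}.

#[short(type="awbType")]
HB.structure Definition AWB (K : fieldType) :=
  {A of Lmodule_isAWB K A & GRing.Lmodule K A}.

Declare Scope awb_scope.
Delimit Scope awb_scope with awb.
Local Open Scope awb_scope.
Notation "a *a b" := (amul a b) (at level 40, left associativity) : awb_scope.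
Notation "[: a , b :]" := (abr a b) (at level 0, format "[:  a ,  b  :]") : awb_scope.

HB.mixin Record isAWBHom (K : fieldType) (A B : awbType K) (f : A -> B) := {
  awbhomM : {morph f : a b / a *a b};
  awbhomB : {morph f : a b / [: a, b :]}
}.

HB.structure Definition AWBHom (K : fieldType) (A B : awbType K) :=
  {f of isAWBHom K A B f & @GRing.Linear K A B *:%R f}.

Notation "{ 'awb' A -> B }" := (AWBHom.type A%type B%type)
  (at level 0, A at level 98, B at level 99, format "{ 'awb'  A  ->  B }") : type_scope.

Definition awb_isomorphic (K : fieldType) (A B : awbType K) : Prop :=
  exists f : {awb A -> B}, bijective f.

HB.mixin Record isAWBSubClosed (K : fieldType) (A : awbType K) (S : A -> bool) := {
  subawbM : {in S &, forall a b, a *a b \in S};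
  subawbB : {in S &, forall a b, [: a, b :] \in S}
}.

#[short(type="subAWB")]
HB.structure Definition SubAWB (K : fieldType) (A : awbType K) :=
  {S of isAWBSubClosed K A S & @GRing.SubmodClosed K A S}.

HB.mixin Record isAWBIdealClosed (K : fieldType) (A : awbType K) (I : A -> bool) := {
  awbidealMl : forall a, {in I, forall x, a *a x \in I};
  awbidealMr : forall a, {in I, forall x, x *a a \in I};
  awbidealBl : forall a, {in I, forall x, [: a, x :] \in I};
  awbidealBr : forall a, {in I, forall x, [: x, a :] \in I}
}.

#[short(type="idealAWB")]
HB.structure Definition IdealAWB (K : fieldType) (A : awbType K) :=
  {I of isAWBIdealClosed K A I & @SubAWB K A I}.

HB.factory Record isAWBIdeal (K : fieldType) (A : awbType K) (I : A -> bool)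
    of @GRing.SubmodClosed K A I := {
  awbidealMl : forall a, {in I, forall x, a *a x \in I};
  awbidealMr : forall a, {in I, forall x, x *a a \in I};
  awbidealBl : forall a, {in I, forall x, [: a, x :] \in I};
  awbidealBr : forall a, {in I, forall x, [: x, a :] \in I}
}.

HB.builders Context K A I of isAWBIdeal K A I.
Fact ideal_subM : {in I &, forall a b, a *a b \in I}.
Proof. by move=> a b _; apply: awbidealMl. Qed.
Fact ideal_subB : {in I &, forall a b, [: a, b :] \in I}.
Proof. by move=> a b _; apply: awbidealBl. Qed.
HB.instance Definition _ := isAWBSubClosed.Build K A I ideal_subM ideal_subB.
HB.instance Definition _ := isAWBIdealClosed.Build K A I
  awbidealMl awbidealMr awbidealBl awbidealBr.
HB.end.

Section AWBTheory.
Variables (K : fieldType) (A : awbType K).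
Implicit Types a b c : A.

Lemma amulZDl b k x y : (k *: x + y) *a b = k *: (x *a b) + y *a b :> A.
Proof. exact: (amul_bilinear (s := A)).1. Qed.
Lemma amulZDr a k x y : a *a (k *: x + y) = k *: (a *a x) + a *a y :> A.
Proof. exact: (amul_bilinear (s := A)).2. Qed.
Lemma abrZDl b k x y : [: k *: x + y, b :] = k *: [: x, b :] + [: y, b :] :> A.
Proof. exact: (abr_bilinear (s := A)).1. Qed.
Lemma abrZDr a k x y : [: a, k *: x + y :] = k *: [: a, x :] + [: a, y :] :> A.
Proof. exact: (abr_bilinear (s := A)).2. Qed.

Lemma amul0l b : 0 *a b = 0 :> A.
Proof. by have := amulZDl b (-1) 0 0; rewrite !scaleN1r !addNr. Qed.
Lemma amul0r a : a *a 0 = 0 :> A.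
Proof. by have := amulZDr a (-1) 0 0; rewrite !scaleN1r !addNr. Qed.
Lemma abr0l b : [: 0, b :] = 0 :> A.
Proof. by have := abrZDl b (-1) 0 0; rewrite !scaleN1r !addNr. Qed.
Lemma abr0r a : [: a, 0 :] = 0 :> A.
Proof. by have := abrZDr a (-1) 0 0; rewrite !scaleN1r !addNr. Qed.

Lemma amulBl x y b : (x - y) *a b = x *a b - y *a b :> A.
Proof. by rewrite addrC -scaleN1r amulZDl scaleN1r addrC. Qed.
Lemma amulBr a x y : a *a (x - y) = a *a x - a *a y :> A.
Proof. by rewrite addrC -scaleN1r amulZDr scaleN1r addrC. Qed.
Lemma abrBl x y b : [: x - y, b :] = [: x, b :] - [: y, b :] :> A.
Proof. by rewrite addrC -scaleN1r abrZDl scaleN1r addrC. Qed.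
Lemma abrBr a x y : [: a, x - y :] = [: a, x :] - [: a, y :] :> A.
Proof. by rewrite addrC -scaleN1r abrZDr scaleN1r addrC. Qed.

End AWBTheory.

Definition subawb (K : fieldType) (A : awbType K) (S : subAWB A) : Type :=
  {x : A | S x}.

Section SubAWBInstance.
Variables (K : fieldType) (A : awbType K) (S : subAWB A).
Local Notation T := (subawb S).

HB.instance Definition _ := SubType.copy T {x : A | S x}.
HB.instance Definition _ := [Choice of T by <:].
HB.instance Definition _ := [SubChoice_isSubLmodule of T by <:].

Definition subawb_val (x : T) : A := val x.

Lemma subawb_val_inj : injective subawb_val.
Proof. exact: val_inj. Qed.

Fact subawb_val_linear : linear subawb_val.
Proof. exact: linearP (val : {linear T -> A}). Qed.
HB.instance Definition _ :=
  GRing.isLinear.Build K T A *:%R subawb_val subawb_val_linear.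

Definition subawb_mul (x y : T) : T :=
  exist _ (val x *a val y) (subawbM _ _ (valP x) (valP y)).
Definition subawb_br (x y : T) : T :=
  exist _ [: val x, val y :] (subawbB _ _ (valP x) (valP y)).

Fact subawb_mul_bilinear : bilinear_for *:%R *:%R subawb_mul.
Proof.
split=> u k x y; apply: subawb_val_inj; rewrite linearP /= /subawb_val /=.
  exact: amulZDl.
exact: amulZDr.
Qed.
Fact subawb_br_bilinear : bilinear_for *:%R *:%R subawb_br.
Proof.
split=> u k x y; apply: subawb_val_inj; rewrite linearP /= /subawb_val /=.
  exact: abrZDl.
exact: abrZDr.
Qed.
Fact subawb_mulA : associative subawb_mul.
Proof. by move=> x y z; apply: subawb_val_inj; apply: amulA. Qed.
Fact subawb_br_mul x y z :
  subawb_br (subawb_mul x y) z =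
  subawb_mul (subawb_br x z) y + subawb_mul x (subawb_br y z).
Proof. by apply: subawb_val_inj; rewrite linearD; apply: abr_amul. Qed.

HB.instance Definition _ := Lmodule_isAWB.Build K T
  subawb_mul_bilinear subawb_br_bilinear subawb_mulA subawb_br_mul.

HB.instance Definition _ := isAWBHom.Build K T A subawb_val
  (fun x y => erefl) (fun x y => erefl).

End SubAWBInstance.
Arguments subawb_val {K A} S.

(* submodClosed does not inherit zmodClosed (it also covers semimodules), whereas
   quotients need a zmodClosed predicate. *)
Definition ideal_pred (K : fieldType) (A : awbType K) (I : idealAWB A) : {pred A} :=
  fun x => x \in I.

Fact ideal_pred_zmod (K : fieldType) (A : awbType K) (I : idealAWB A) :
  zmod_closed (ideal_pred I).
Proof. exact: GRing.submod_closedB (GRing.submodClosedP I). Qed.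
HB.instance Definition _ (K : fieldType) (A : awbType K) (I : idealAWB A) :=
  GRing.isZmodClosed.Build A (ideal_pred I) (ideal_pred_zmod I).

Definition quotawb (K : fieldType) (A : awbType K) (I : idealAWB A) : Type :=
  Quotient.quot (ideal_pred I).

Section QuotAWBInstance.
Variables (K : fieldType) (A : awbType K) (I : idealAWB A).
Local Notation T := (quotawb I).

HB.instance Definition _ := GRing.Zmodule.copy T (Quotient.quot (ideal_pred I)).
HB.instance Definition _ := EqQuotient.copy T (Quotient.quot (ideal_pred I)).

Definition quotawb_pi (x : A) : T := \pi_(Quotient.quot (ideal_pred I)) x.

Lemma quotawb_piE x y : (quotawb_pi x = quotawb_pi y) <-> (x - y \in I).
Proof.
have -> : (x - y \in I) = (x - y \in ideal_pred I) by [].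
by rewrite Quotient.idealrBE; split=> /eqP.
Qed.

Lemma quotawb_pi_surj (q : T) : exists x, quotawb_pi x = q.
Proof. by exists (repr q); rewrite /quotawb_pi; exact: reprK. Qed.

Lemma quotawb_piB x y : quotawb_pi (x - y) = quotawb_pi x - quotawb_pi y.
Proof. exact: (raddfB (\pi_(Quotient.quot (ideal_pred I)))). Qed.

Lemma quotawb_piD x y : quotawb_pi (x + y) = quotawb_pi x + quotawb_pi y.
Proof. exact: (raddfD (\pi_(Quotient.quot (ideal_pred I)))). Qed.

Lemma repr_pi x : repr (quotawb_pi x) - x \in I.
Proof. by apply/quotawb_piE; rewrite /quotawb_pi; exact: reprK. Qed.

Definition quotawb_scale (k : K) (q : T) : T := quotawb_pi (k *: repr q).
Definition quotawb_mul (p q : T) : T := quotawb_pi (repr p *a repr q).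
Definition quotawb_br (p q : T) : T := quotawb_pi [: repr p, repr q :].

Lemma quotawb_piZ k x : quotawb_pi (k *: x) = quotawb_scale k (quotawb_pi x).
Proof.
by apply/esym/quotawb_piE; rewrite -scalerBr; apply: rpredZ; apply: repr_pi.
Qed.

Lemma quotawb_piM x y : quotawb_pi (x *a y) = quotawb_mul (quotawb_pi x) (quotawb_pi y).
Proof.
apply/esym/quotawb_piE; set x' := repr _; set y' := repr _.
rewrite -(subrKA (x *a y') _ (- (x *a y))) -amulBl -amulBr.
by apply: rpredD; [apply: awbidealMr | apply: awbidealMl]; apply: repr_pi.
Qed.

Lemma quotawb_piBr x y :
  quotawb_pi [: x, y :] = quotawb_br (quotawb_pi x) (quotawb_pi y).
Proof.
apply/esym/quotawb_piE; set x' := repr _; set y' := repr _.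
rewrite -(subrKA [: x, y' :] _ (- [: x, y :])) -abrBl -abrBr.
by apply: rpredD; [apply: awbidealBr | apply: awbidealBl]; apply: repr_pi.
Qed.

Fact quotawb_scaleA a b v :
  quotawb_scale a (quotawb_scale b v) = quotawb_scale (a * b) v.
Proof.
by case: (quotawb_pi_surj v) => x <-; rewrite -!quotawb_piZ scalerA.
Qed.
Fact quotawb_scale1 : left_id 1 quotawb_scale.
Proof. by move=> v; case: (quotawb_pi_surj v) => x <-; rewrite -quotawb_piZ scale1r. Qed.
Fact quotawb_scaleDr : right_distributive quotawb_scale +%R.
Proof.
move=> k u v; case: (quotawb_pi_surj u) => x <-; case: (quotawb_pi_surj v) => y <-.
by rewrite -quotawb_piD -!quotawb_piZ -quotawb_piD scalerDr.
Qed.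
Fact quotawb_scaleDl v : {morph quotawb_scale^~ v : a b / a + b}.
Proof.
move=> a b; case: (quotawb_pi_surj v) => x <-.
by rewrite -!quotawb_piZ -quotawb_piD scalerDl.
Qed.
HB.instance Definition _ := GRing.Zmodule_isLmodule.Build K T
  quotawb_scaleA quotawb_scale1 quotawb_scaleDr quotawb_scaleDl.

Fact quotawb_pi_linear : linear quotawb_pi.
Proof. by move=> k x y; rewrite quotawb_piD quotawb_piZ. Qed.
HB.instance Definition _ :=
  GRing.isLinear.Build K A T *:%R quotawb_pi quotawb_pi_linear.

Fact quotawb_mul_bilinear : bilinear_for *:%R *:%R quotawb_mul.
Proof.
split=> u k x y; case: (quotawb_pi_surj u) => a <-;
  case: (quotawb_pi_surj x) => b <-; case: (quotawb_pi_surj y) => c <-.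
  by rewrite -linearP -!quotawb_piM amulZDl linearP.
by rewrite -linearP -!quotawb_piM amulZDr linearP.
Qed.
Fact quotawb_br_bilinear : bilinear_for *:%R *:%R quotawb_br.
Proof.
split=> u k x y; case: (quotawb_pi_surj u) => a <-;
  case: (quotawb_pi_surj x) => b <-; case: (quotawb_pi_surj y) => c <-.
  by rewrite -linearP -!quotawb_piBr abrZDl linearP.
by rewrite -linearP -!quotawb_piBr abrZDr linearP.
Qed.
Fact quotawb_mulA : associative quotawb_mul.
Proof.
move=> x y z; case: (quotawb_pi_surj x) => a <-;
  case: (quotawb_pi_surj y) => b <-; case: (quotawb_pi_surj z) => c <-.
by rewrite -!quotawb_piM amulA.
Qed.
Fact quotawb_br_mul x y z :
  quotawb_br (quotawb_mul x y) z =
  quotawb_mul (quotawb_br x z) y + quotawb_mul x (quotawb_br y z).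
Proof.
case: (quotawb_pi_surj x) => a <-;
  case: (quotawb_pi_surj y) => b <-; case: (quotawb_pi_surj z) => c <-.
by rewrite -!(quotawb_piM, quotawb_piBr) -quotawb_piD abr_amul.
Qed.
HB.instance Definition _ := Lmodule_isAWB.Build K T
  quotawb_mul_bilinear quotawb_br_bilinear quotawb_mulA quotawb_br_mul.
HB.instance Definition _ := isAWBHom.Build K A T quotawb_pi quotawb_piM quotawb_piBr.

End QuotAWBInstance.
Arguments quotawb_pi {K A} I.

Section CenterCommutator.
Variables (K : fieldType) (A : awbType K).

Definition is_central (a : A) : Prop :=
  forall b : A, [/\ a *a b = 0, b *a a = 0, [: a, b :] = 0 & [: b, a :] = 0].

Definition awb_center : {pred A} := fun a => `[< is_central a >].

Lemma awb_centerP a : reflect (is_central a) (a \in awb_center).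
Proof. exact: asboolP. Qed.

Fact awb_center_submod : submod_closed awb_center.
Proof.
split; first by apply/awb_centerP => b; rewrite amul0l amul0r abr0l abr0r.
move=> k x y /awb_centerP Zx /awb_centerP Zy; apply/awb_centerP => b.
case: (Zx b) (Zy b) => x1 x2 x3 x4 [y1 y2 y3 y4].
rewrite amulZDl amulZDr abrZDl abrZDr x1 x2 x3 x4 y1 y2 y3 y4.
by rewrite scaler0 addr0.
Qed.
HB.instance Definition _ := GRing.isSubmodClosed.Build K A awb_center awb_center_submod.

Fact awb_center_Ml a : {in awb_center, forall x, a *a x \in awb_center}.
Proof. by move=> x /awb_centerP /(_ a) [_ -> _ _]; apply: rpred0. Qed.
Fact awb_center_Mr a : {in awb_center, forall x, x *a a \in awb_center}.
Proof. by move=> x /awb_centerP /(_ a) [-> _ _ _]; apply: rpred0. Qed.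
Fact awb_center_Bl a : {in awb_center, forall x, [: a, x :] \in awb_center}.
Proof. by move=> x /awb_centerP /(_ a) [_ _ _ ->]; apply: rpred0. Qed.
Fact awb_center_Br a : {in awb_center, forall x, [: x, a :] \in awb_center}.
Proof. by move=> x /awb_centerP /(_ a) [_ _ -> _]; apply: rpred0. Qed.
HB.instance Definition _ := isAWBIdeal.Build K A awb_center
  awb_center_Ml awb_center_Mr awb_center_Bl awb_center_Br.

(* The linear span of all products and brackets; it absorbs every product and
   bracket, hence it is also the two-sided ideal they generate. *)
Definition in_commutator (x : A) : Prop :=
  forall V : submodClosed A,
    (forall a b : A, a *a b \in V) -> (forall a b : A, [: a, b :] \in V) -> x \in V.

Definition awb_commutator : {pred A} := fun x => `[< in_commutator x >].

Lemma awb_commutatorP x : reflect (in_commutator x) (x \in awb_commutator).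
Proof. exact: asboolP. Qed.

Lemma amul_commutator a b : a *a b \in awb_commutator.
Proof. by apply/awb_commutatorP => V VM VB. Qed.
Lemma abr_commutator a b : [: a, b :] \in awb_commutator.
Proof. by apply/awb_commutatorP => V VM VB. Qed.

Fact awb_commutator_submod : submod_closed awb_commutator.
Proof.
split; first by apply/awb_commutatorP => V VM VB; apply: rpred0.
move=> k x y /awb_commutatorP Cx /awb_commutatorP Cy.
by apply/awb_commutatorP => V VM VB; rewrite rpredD ?rpredZ ?Cx ?Cy.
Qed.
HB.instance Definition _ :=
  GRing.isSubmodClosed.Build K A awb_commutator awb_commutator_submod.
HB.instance Definition _ := isAWBIdeal.Build K A awb_commutator
  (fun a x _ => amul_commutator a x) (fun a x _ => amul_commutator x a)
  (fun a x _ => abr_commutator a x) (fun a x _ => abr_commutator x a).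

Definition commutator_mul (a b : A) : subawb awb_commutator :=
  exist _ (a *a b) (amul_commutator a b).
Definition commutator_br (a b : A) : subawb awb_commutator :=
  exist _ [: a, b :] (abr_commutator a b).

End CenterCommutator.
Arguments awb_center {K} A.
Arguments awb_commutator {K} A.

Record central_ext (K : fieldType) := CentralExt {
  ext_ker : awbType K;
  ext_alg : awbType K;
  ext_quo : awbType K;
  ext_inj : {awb ext_ker -> ext_alg};
  ext_proj : {awb ext_alg -> ext_quo};
  ext_inj_inj : injective ext_inj;
  ext_exact : forall g, ext_proj g = 0 <-> exists n, ext_inj n = g;
  ext_proj_surj : forall q, exists g, ext_proj g = q;
  ext_central : forall n, ext_inj n \in awb_center ext_alg
}.

Section CommutatorMaps.
Variables (K : fieldType) (E : central_ext K).

Definition ext_lift (q : ext_quo E) : ext_alg E := sval (cid (ext_proj_surj q)).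

Lemma ext_liftK q : ext_proj E (ext_lift q) = q.
Proof. exact: svalP (cid (ext_proj_surj q)). Qed.

Definition ext_C (p q : ext_quo E) : subawb (awb_commutator (ext_alg E)) :=
  commutator_br (ext_lift p) (ext_lift q).
Definition ext_P (p q : ext_quo E) : subawb (awb_commutator (ext_alg E)) :=
  commutator_mul (ext_lift p) (ext_lift q).

Lemma ext_lift_proj g : is_central (ext_lift (ext_proj E g) - g).
Proof.
have /ext_exact [n <-] : ext_proj E (ext_lift (ext_proj E g) - g) = 0.
  by rewrite linearB /= ext_liftK subrr.
exact/awb_centerP/ext_central.
Qed.

Lemma ext_CE g h : ext_C (ext_proj E g) (ext_proj E h) = commutator_br g h.
Proof.
apply: val_inj => /=; set g' := ext_lift _; set h' := ext_lift _.
have [_ _ + _] := ext_lift_proj g h'; rewrite abrBl => /subr0_eq ->.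
by have [_ _ _ +] := ext_lift_proj h g; rewrite abrBr => /subr0_eq ->.
Qed.

Lemma ext_PE g h : ext_P (ext_proj E g) (ext_proj E h) = commutator_mul g h.
Proof.
apply: val_inj => /=; set g' := ext_lift _; set h' := ext_lift _.
have [+ _ _ _] := ext_lift_proj g h'; rewrite amulBl => /subr0_eq ->.
by have [_ + _ _] := ext_lift_proj h g; rewrite amulBr => /subr0_eq ->.
Qed.

End CommutatorMaps.

Section Isoclinism.
Variables (K : fieldType) (E1 E2 : central_ext K).

Record is_isoclinism (eta : {awb ext_quo E1 -> ext_quo E2})
    (xi : {awb subawb (awb_commutator (ext_alg E1)) ->
               subawb (awb_commutator (ext_alg E2))}) : Prop := IsIsoclinism {
  isoclinism_eta_bij : bijective eta;
  isoclinism_xi_bij : bijective xi;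
  isoclinism_C : forall p q, xi (ext_C p q) = ext_C (eta p) (eta q);
  isoclinism_P : forall p q, xi (ext_P p q) = ext_P (eta p) (eta q)
}.

Definition ext_isoclinic : Prop := exists eta xi, @is_isoclinism eta xi.

Record ext_hom := ExtHom {
  hom_ker : {awb ext_ker E1 -> ext_ker E2};
  hom_alg : {awb ext_alg E1 -> ext_alg E2};
  hom_quo : {awb ext_quo E1 -> ext_quo E2};
  hom_inj_comm : forall n, hom_alg (ext_inj E1 n) = ext_inj E2 (hom_ker n);
  hom_proj_comm : forall g, hom_quo (ext_proj E1 g) = ext_proj E2 (hom_alg g)
}.

Definition isoclinic_hom (h : ext_hom) : Prop :=
  exists beta', is_isoclinism (hom_quo h) beta'.

Definition isoclinic_epi (h : ext_hom) : Prop :=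
  isoclinic_hom h /\ (forall g2, exists g1, hom_alg h g1 = g2).

Definition isoclinic_mono (h : ext_hom) : Prop :=
  isoclinic_hom h /\ injective (hom_alg h).

End Isoclinism.

Section CenterExt.
Variables (K : fieldType) (A : awbType K).

Let ZA : idealAWB A := awb_center A.

Fact center_ext_inj : injective (subawb_val ZA).
Proof. exact: subawb_val_inj. Qed.
Fact center_ext_exact g : quotawb_pi ZA g = 0 <-> exists n, subawb_val ZA n = g.
Proof.
rewrite -(linear0 (quotawb_pi ZA)) quotawb_piE subr0; split=> [Zg | [n <-]].
  by exists (exist _ g Zg).
exact: valP.
Qed.
Fact center_ext_central n : subawb_val ZA n \in awb_center A.
Proof. exact: valP. Qed.

Definition center_ext : central_ext K :=
  @CentralExt K (subawb ZA) A (quotawb ZA) (subawb_val ZA) (quotawb_pi ZA)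
    center_ext_inj center_ext_exact (@quotawb_pi_surj K A ZA) center_ext_central.

End CenterExt.

Definition awb_isoclinic (K : fieldType) (A B : awbType K) : Prop :=
  ext_isoclinic (center_ext A) (center_ext B).

(* Main.v *)
Require Import Defs.
From HB Require Import structures.
From mathcomp Require Import boolp classical_sets.
From mathcomp Require Import all_boot all_algebra.

(** The decisive fact is that over a field every isoclinism [(eta, xi)] from
    [E] to [F] is induced by a homomorphism of extensions ([isoclinism_hom]).
    Choose a linear complement [C] of the commutator ideal of the algebra of
    [E], let [beta] be [xi] on the commutator ideal, and on [C] let [beta] be
    any linear lift of [eta].  Products and brackets land in the commutator
    ideal, where [xi] carries them to the commutator maps of [F]; so [beta] is
    multiplicative, whatever lift was chosen on [C].

    In return, a homomorphism of extensions is isoclinic exactly when it is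
    bijective on the quotients and injective on the commutator ideal
    ([isoclinic_homP]).  Neither condition is affected by an additional direct
    factor with zero product and bracket, and such a factor is enough to make
    [beta] surjective or injective.  For (b), take [G1 * N2] with [N2] abelian
    and map [(g, n)] to [beta g + n]: this is onto because [beta] misses [G2]
    only by elements of [N2] ([abprod_ext_epi]).  For (c), take [G2 * G1] with
    the second factor abelian and map [g] to [(beta g, p g)], where [p] is a
    linear projection whose kernel is the commutator ideal: [beta] is injective
    on that kernel ([abprod_ext_mono]).  The other legs are the projection
    [G1 * N2 -> G1] and the inclusion [G2 -> G2 * G1].  Conversely, isoclinic
    homomorphisms are isoclinisms, and these form an equivalence relation.

    For the statements about ideals and subalgebras, both conditions of
    [isoclinic_homP] pass from the given extensions to the extensions by the
    centers ([cocentral_awb_isoclinic]): a homomorphism [A -> B] that is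
    injective on the commutator ideal and reaches every element of [B] up to
    the center identifies [Z(A)] with the preimage of [Z(B)].  It remains to
    use the isomorphism theorem for the kernel or the image. *)

Set Implicit Arguments.
Unset Strict Implicit.
Unset Printing Implicit Defensive.

Import GRing.Theory.

Local Open Scope ring_scope.
Local Open Scope awb_scope.

(** * Linear algebra in arbitrary dimension *)

Section LinearAlgebra.
Variable K : fieldType.

Lemma linear_of (U V : lmodType K) (f : U -> V) :
  linear f -> exists g : {linear U -> V}, g =1 f.
Proof.
move=> fL.
pose g : {linear U -> V} := HB.pack f (GRing.isLinear.Build K U V *:%R f fL).
by exists g.
Qed.

(** Every subspace has a linear complement: [p] is the projection onto it.
    The complement is a maximal subspace that meets [W] only in [0]. *)
Lemma linear_retraction (V : lmodType K) (W : submodClosed V) :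
  exists p : {linear V -> V},
    (forall v, v - p v \in W) /\ (forall w, w \in W -> p w = 0).
Proof.
pose indep (U : set V) := (forall k x y, U x -> U y -> U (k *: x + y)) /\
  (forall x, U x -> x \in W -> x = 0).
have [F FP Ftot|U [[Ulin UW] Umax]] := @Zorn_bigcup V indep.
  split=> [k x y [A FA Ax] [B FB By]|x [A FA Ax]]; last exact: (FP A FA).2.
  case: (Ftot A B FA FB) => [AB|BA].
    by exists B => //; apply: (FP B FB).1 => //; apply: AB.
  by exists A => //; apply: (FP A FA).1 => //; apply: BA.
(* The empty set, the union of the empty chain, satisfies indep; so that 0 lies
   in U must come from maximality. *)
have U0 : U 0.
  have [//|nU0] := pselect (U 0).
  case: (Umax (fun x => x = 0)).
    split=> [x Ux|/(_ 0 erefl)//]; case: nU0.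
    by rewrite -(addNr x) -scaleN1r; apply: Ulin.
  by split=> [k x y -> ->|x -> //]; rewrite scaler0 addr0.
have Usum g : exists u, U u /\ g - u \in W.
  apply: contrapT => nog.
  (* The span of U and g still meets W trivially, against maximality. *)
  apply: (Umax (fun z => exists k u, U u /\ z = k *: g + u)).
    split=> [u Uu|BU]; first by exists 0, u; rewrite scale0r add0r.
    apply: nog; exists g; rewrite subrr rpred0; split=> //.
    by apply: BU; exists 1, 0; rewrite scale1r addr0.
  split=> [k x y [a [u [Uu ->]]] [b [v [Uv ->]]]|x [a [u [Uu ->]]] Wx].
    exists (k * a + b), (k *: u + v); split; first exact: Ulin.
    by rewrite scalerDr scalerA scalerDl addrACA.
  have [a0|a0] := eqVneq a 0.
    by move: Wx; rewrite a0 scale0r add0r; apply: UW.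
  case: nog; exists (- a^-1 *: u + 0); split; first exact: Ulin.
  rewrite addr0 scaleNr opprK -[g]scale1r -(mulVf a0) -scalerA -scalerDr.
  exact: rpredZ.
have Uuniq x y : U x -> U y -> x - y \in W -> x = y.
  move=> Ux Uy Wxy; apply/eqP; rewrite -subr_eq0; apply/eqP; apply: UW => //.
  by rewrite addrC -scaleN1r; apply: Ulin.
have WB x y : x \in W -> y \in W -> x - y \in W.
  by move=> Wx Wy; rewrite addrC -scaleN1r rpredD ?rpredZ.
have [f fP] := choice Usum.
have [|p pE] := @linear_of V V f.
  move=> k x y; apply: Uuniq; first exact: (fP _).1.
    by apply: Ulin; apply: (fP _).1.
  have -> : f (k *: x + y) - (k *: f x + f y) =
      (k *: (x - f x) + (y - f y)) - (k *: x + y - f (k *: x + y)).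
    by rewrite scalerBr addrACA -opprD opprB [RHS]addrC subrKA.
  by apply: WB; [rewrite rpredD ?rpredZ ?(fP _).2 | apply: (fP _).2].
exists p; split=> [v|w Ww]; rewrite pE; first exact: (fP v).2.
apply: UW; first exact: (fP w).1.
by rewrite -(subKr w (f w)); apply: WB => //; apply: (fP w).2.
Qed.

Lemma linear_factor (A Q B : lmodType K) (p : {linear A -> Q})
    (g : {linear A -> B}) :
    (forall q, exists a, p a = q) -> (forall a, p a = 0 -> g a = 0) ->
  exists h : {linear Q -> B}, forall a, h (p a) = g a.
Proof.
move=> /choice[s sK] pg.
have gs a : g (s (p a)) = g a.
  by apply/eqP; rewrite -subr_eq0 -linearB; apply/eqP/pg; rewrite linearB /= sK subrr.
have [|h hE] := @linear_of Q B (g \o s).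
  by move=> k x y /=; rewrite -linearP -(gs (k *: s x + s y)) linearP !sK.
by exists h => a; rewrite hE /= gs.
Qed.

End LinearAlgebra.

(** * Homomorphisms of algebras with bracket *)

Section Homs.
Variable K : fieldType.
Implicit Types A B C N Q : awbType K.

Lemma awb_hom_of A B (f : A -> B) :
    linear f -> {morph f : a b / a *a b} -> {morph f : a b / [: a, b :]} ->
  exists g : {awb A -> B}, g =1 f.
Proof.
move=> fL fM fB.
pose g : {awb A -> B} := HB.pack f (GRing.isLinear.Build K A B *:%R f fL)
  (isAWBHom.Build K A B f fM fB).
by exists g.
Qed.

Lemma awb_comp A B C (g : {awb B -> C}) (f : {awb A -> B}) :
  exists h : {awb A -> C}, h =1 g \o f.
Proof.
by apply: awb_hom_of => [k x y|x y|x y] /=; rewrite ?linearP ?awbhomM ?awbhomB.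
Qed.

Lemma awb_id A : exists h : {awb A -> A}, h =1 id.
Proof. exact: awb_hom_of. Qed.

Lemma awb_factor A Q B (p : {awb A -> Q}) (g : {awb A -> B}) :
    (forall q, exists a, p a = q) -> (forall a, p a = 0 -> g a = 0) ->
  exists h : {awb Q -> B}, forall a, h (p a) = g a.
Proof.
move=> psurj pg; have [h hLE] := linear_factor psurj pg.
have hE a : h (p a) = g a := hLE a.
have [|x y|x y|h' h'E] := @awb_hom_of Q B h; first exact: linearP.
- have [a <-] := psurj x; have [b <-] := psurj y.
  by rewrite -awbhomM !hE awbhomM.
- have [a <-] := psurj x; have [b <-] := psurj y.
  by rewrite -awbhomB !hE awbhomB.
by exists h' => a; rewrite h'E hE.
Qed.

(** Used with [c] the inclusion of a subalgebra or of the kernel of an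
    extension, to restrict the codomain of [f]. *)
Lemma awb_lift A N B (c : {awb N -> B}) (f : {awb A -> B}) :
    injective c -> (forall a, exists n, c n = f a) ->
  exists h : {awb A -> N}, forall a, c (h a) = f a.
Proof.
move=> cinj /choice[s sK].
have [k x y|x y|x y|h hE] := @awb_hom_of A N s.
- by apply: cinj; rewrite [RHS]linearP /= !sK linearP.
- by apply: cinj; rewrite awbhomM !sK awbhomM.
- by apply: cinj; rewrite awbhomB !sK awbhomB.
by exists h => a; rewrite hE sK.
Qed.

Lemma awb_inj A B (f : {awb A -> B}) :
  (forall a, f a = 0 -> a = 0) -> injective f.
Proof.
move=> f0 x y fxy; apply/eqP; rewrite -subr_eq0; apply/eqP/f0.
by rewrite linearB /= fxy subrr.
Qed.

Lemma bij_of_inj_surj (S T : Type) (f : S -> T) :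
  injective f -> (forall y, exists x, f x = y) -> bijective f.
Proof.
move=> finj /choice[g gK]; exists g => // x.
by apply: finj; rewrite gK.
Qed.

Lemma bij_surj (S T : Type) (f : S -> T) :
  bijective f -> forall y, exists x, f x = y.
Proof. by move=> [g _ gK] y; exists (g y). Qed.

Lemma awb_inverse A B (f : {awb A -> B}) :
  bijective f -> exists2 g : {awb B -> A}, cancel f g & cancel g f.
Proof.
move=> fbij; have fsurj := bij_surj fbij.
have [i iE] := awb_id A.
have [a fa0|g gK] := @awb_factor A B A f i fsurj.
  by rewrite iE; apply: (bij_inj fbij); rewrite fa0 linear0.
exists g => [a|b]; first by rewrite gK iE.
by have [a <-] := fsurj b; rewrite gK iE.
Qed.

Lemma awb_isomorphic_sym A B : awb_isomorphic A B -> awb_isomorphic B A.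
Proof. by move=> [f /awb_inverse[g fK gK]]; exists g, f. Qed.

Section KernelImage.
Variables (A B : awbType K) (f : {awb A -> B}).

Definition awb_ker : {pred A} := fun a => f a == 0.

Lemma awb_kerE a : (a \in awb_ker) = (f a == 0). Proof. by []. Qed.

Fact awb_ker_submod : submod_closed awb_ker.
Proof.
split=> [|k x y]; rewrite !awb_kerE ?linear0 // => /eqP fx /eqP fy.
by rewrite linearP /= fx fy scaler0 addr0.
Qed.
HB.instance Definition _ := GRing.isSubmodClosed.Build K A awb_ker awb_ker_submod.

Fact awb_ker_Ml a : {in awb_ker, forall x, a *a x \in awb_ker}.
Proof. by move=> x; rewrite !awb_kerE awbhomM => /eqP ->; rewrite amul0r. Qed.
Fact awb_ker_Mr a : {in awb_ker, forall x, x *a a \in awb_ker}.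
Proof. by move=> x; rewrite !awb_kerE awbhomM => /eqP ->; rewrite amul0l. Qed.
Fact awb_ker_Bl a : {in awb_ker, forall x, [: a, x :] \in awb_ker}.
Proof. by move=> x; rewrite !awb_kerE awbhomB => /eqP ->; rewrite abr0r. Qed.
Fact awb_ker_Br a : {in awb_ker, forall x, [: x, a :] \in awb_ker}.
Proof. by move=> x; rewrite !awb_kerE awbhomB => /eqP ->; rewrite abr0l. Qed.
HB.instance Definition _ := isAWBIdeal.Build K A awb_ker
  awb_ker_Ml awb_ker_Mr awb_ker_Bl awb_ker_Br.

Definition awb_img : {pred B} := fun b => `[< exists a, f a = b >].

Lemma awb_imgP b : reflect (exists a, f a = b) (b \in awb_img).
Proof. exact: asboolP. Qed.

Fact awb_img_submod : submod_closed awb_img.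
Proof.
split; first by apply/awb_imgP; exists 0; rewrite linear0.
move=> k x y /awb_imgP[a <-] /awb_imgP[b <-].
by apply/awb_imgP; exists (k *: a + b); rewrite linearP.
Qed.
HB.instance Definition _ := GRing.isSubmodClosed.Build K B awb_img awb_img_submod.

Fact awb_img_M : {in awb_img &, forall x y, x *a y \in awb_img}.
Proof.
move=> x y /awb_imgP[a <-] /awb_imgP[b <-].
by apply/awb_imgP; exists (a *a b); rewrite awbhomM.
Qed.
Fact awb_img_B : {in awb_img &, forall x y, [: x, y :] \in awb_img}.
Proof.
move=> x y /awb_imgP[a <-] /awb_imgP[b <-].
by apply/awb_imgP; exists [: a, b :]; rewrite awbhomB.
Qed.
HB.instance Definition _ := isAWBSubClosed.Build K B awb_img awb_img_M awb_img_B.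

Lemma first_isomorphism :
  (forall b, exists a, f a = b) -> awb_isomorphic (quotawb awb_ker) B.
Proof.
move=> fsurj.
have piE a : (quotawb_pi awb_ker a = 0) <-> (f a = 0).
  rewrite -(linear0 (quotawb_pi awb_ker)) quotawb_piE subr0 awb_kerE.
  by split=> /eqP.
have [a /piE//|h hE] := @awb_factor A (quotawb awb_ker) B (quotawb_pi awb_ker) f
  (@quotawb_pi_surj K A awb_ker).
exists h; apply: bij_of_inj_surj => [|b].
  apply: awb_inj => q; have [a <-] := quotawb_pi_surj q.
  by rewrite hE => /piE.
by have [a <-] := fsurj b; exists (quotawb_pi awb_ker a); rewrite hE.
Qed.

Lemma injective_isomorphism :
  injective f -> awb_isomorphic A (subawb awb_img).
Proof.
move=> finj; have [|a|h hE] := @awb_lift A (subawb awb_img) B (subawb_val awb_img) f.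
- exact: subawb_val_inj.
- have fa : f a \in awb_img by apply/awb_imgP; exists a.
  by exists (exist _ (f a) fa).
exists h; apply: bij_of_inj_surj => [x y hxy|y].
  by apply: finj; rewrite -!hE hxy.
have /awb_imgP[a fa] := valP y.
by exists a; apply: subawb_val_inj; rewrite hE fa.
Qed.

End KernelImage.

End Homs.

(** * The commutator ideal *)

Section Commutator.
Variable K : fieldType.
Implicit Types A B : awbType K.

Lemma commutator_sub A (P : A -> Prop) :
    P 0 -> (forall k x y, P x -> P y -> P (k *: x + y)) ->
    (forall a b, P (a *a b)) -> (forall a b, P [: a, b :]) ->
  forall x, x \in awb_commutator A -> P x.
Proof.
move=> P0 PL PM PB x /awb_commutatorP Cx.
pose S : {pred A} := fun x => `[< P x >].
have Scl : submod_closed S.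
  split; first exact/asboolP.
  by move=> k y z /asboolP Py /asboolP Pz; apply/asboolP/PL.
pose V : submodClosed A := HB.pack S (GRing.isSubmodClosed.Build K A S Scl).
by have /asboolP := Cx V (fun a b => asboolT (PM a b)) (fun a b => asboolT (PB a b)).
Qed.

Lemma commutator_ind A (P : subawb (awb_commutator A) -> Prop) :
    P 0 -> (forall k x y, P x -> P y -> P (k *: x + y)) ->
    (forall a b, P (commutator_mul a b)) ->
    (forall a b, P (commutator_br a b)) ->
  forall x, P x.
Proof.
move=> P0 PL PM PB x.
have [y /val_inj-> //] : exists2 y, val x = val y & P y.
apply: (@commutator_sub A (fun a => exists2 y, a = val y & P y)) (valP x).
- by exists 0.
- by move=> k _ _ [a -> Pa] [b -> Pb]; exists (k *: a + b) => //; apply: PL.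
- by move=> a b; exists (commutator_mul a b).
- by move=> a b; exists (commutator_br a b).
Qed.

(** The second component of an isoclinism is thereby determined by the first
    one, and the one induced by a homomorphism is its restriction. *)
Lemma commutator_linear_eq A (V : lmodType K)
    (f g : {linear subawb (awb_commutator A) -> V}) :
    (forall a b, f (commutator_mul a b) = g (commutator_mul a b)) ->
    (forall a b, f (commutator_br a b) = g (commutator_br a b)) ->
  f =1 g.
Proof.
move=> fgM fgB; apply: commutator_ind => //; first by rewrite !linear0.
by move=> k x y fgx fgy; rewrite !linearP /= fgx fgy.
Qed.

Lemma commutator_hom A B (f : {awb A -> B}) x :
  x \in awb_commutator A -> f x \in awb_commutator B.
Proof.
move: x; apply: commutator_sub => [|k x y fx fy|a b|a b].
- by rewrite linear0 rpred0.
- by rewrite linearP rpredD ?rpredZ.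
- by rewrite awbhomM amul_commutator.
- by rewrite awbhomB abr_commutator.
Qed.

Lemma commutator_restrict A B (f : {awb A -> B}) :
  exists g : {awb subawb (awb_commutator A) -> subawb (awb_commutator B)},
    forall x, val (g x) = f (val x).
Proof.
have [r rE] := awb_comp f (subawb_val (awb_commutator A)).
have [|x|g gE] := @awb_lift _ _ _ _ (subawb_val (awb_commutator B)) r.
- exact: subawb_val_inj.
- have fx : f (val x) \in awb_commutator B by apply/commutator_hom/valP.
  by exists (exist _ (f (val x)) fx); rewrite rE.
by exists g => x; have := gE x; rewrite rE.
Qed.

Lemma central_diffM A (a a' b b' : A) :
  is_central (a' - a) -> is_central (b' - b) -> a' *a b' = a *a b.
Proof.
move=> /(_ b')[+ _ _ _] /(_ a)[_ + _ _].
by rewrite amulBl amulBr => /subr0_eq-> /subr0_eq.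
Qed.

Lemma central_diffB A (a a' b b' : A) :
  is_central (a' - a) -> is_central (b' - b) -> [: a', b' :] = [: a, b :].
Proof.
move=> /(_ b')[_ _ + _] /(_ a)[_ _ _ +].
by rewrite abrBl abrBr => /subr0_eq-> /subr0_eq.
Qed.

(** Products and brackets do not see central summands, so each generator
    [b *a b'] of the commutator ideal of [B] is already a product of two values
    of [f]; this gives surjectivity. *)
Lemma commutator_restrict_bij A B (f : {awb A -> B})
    (g : {awb subawb (awb_commutator A) -> subawb (awb_commutator B)}) :
    (forall x, val (g x) = f (val x)) ->
    (forall b, exists a, is_central (b - f a)) ->
    {in awb_commutator A, forall x, f x = 0 -> x = 0} ->
  bijective g.
Proof.
move=> gE fsurj finj; apply: bij_of_inj_surj.
  apply: awb_inj => x gx0; apply: val_inj; apply: finj; first exact: valP.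
  by rewrite -gE gx0.
apply: commutator_ind => [|k _ _ [x <-] [y <-]|a b|a b].
- by exists 0; rewrite linear0.
- by exists (k *: x + y); rewrite linearP.
- have [a' Za] := fsurj a; have [b' Zb] := fsurj b.
  exists (commutator_mul a' b'); apply: val_inj; rewrite gE /= awbhomM.
  by rewrite (central_diffM Za Zb).
- have [a' Za] := fsurj a; have [b' Zb] := fsurj b.
  exists (commutator_br a' b'); apply: val_inj; rewrite gE /= awbhomB.
  by rewrite (central_diffB Za Zb).
Qed.

End Commutator.

(** * Isoclinic homomorphisms *)

Section IsoclinicHoms.
Variable K : fieldType.
Implicit Types (E F : central_ext K) (A B : awbType K).

Lemma ext_isoclinic_sym E F : ext_isoclinic E F -> ext_isoclinic F E.
Proof.
move=> [eta [xi [/awb_inverse[eta' etaK eta'K] /awb_inverse[xi' xiK xi'K] xiC xiP]]].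
exists eta', xi'; split; [by exists eta | by exists xi | |] => p q;
  apply: (can_inj xiK); rewrite xi'K ?xiC ?xiP !eta'K //.
Qed.

Lemma ext_isoclinic_trans E F G :
  ext_isoclinic E F -> ext_isoclinic F G -> ext_isoclinic E G.
Proof.
move=> [e [x [eb xb xC xP]]] [e' [x' [eb' xb' xC' xP']]].
have [e2 e2E] := awb_comp e' e; have [x2 x2E] := awb_comp x' x.
exists e2, x2; split=> [| |p q|p q].
- exact: (eq_bij (bij_comp eb' eb) (fsym e2E)).
- exact: (eq_bij (bij_comp xb' xb) (fsym x2E)).
- by rewrite x2E /= xC xC' !e2E.
- by rewrite x2E /= xP xP' !e2E.
Qed.

Lemma ext_ker_central E g : ext_proj E g = 0 -> is_central g.
Proof. by move=> /ext_exact[n <-]; apply/awb_centerP/ext_central. Qed.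

Lemma ext_hom_exists E F (b : {awb ext_alg E -> ext_alg F})
    (c : {awb ext_quo E -> ext_quo F}) :
    (forall g, c (ext_proj E g) = ext_proj F (b g)) ->
  exists h : ext_hom E F, hom_alg h = b /\ hom_quo h = c.
Proof.
move=> bc; have [r rE] := awb_comp b (ext_inj E).
have [|n|a aE] := @awb_lift _ _ _ _ (ext_inj F) r; first exact: ext_inj_inj.
  rewrite rE; apply/ext_exact; rewrite -bc.
  suff -> : ext_proj E (ext_inj E n) = 0 by rewrite linear0.
  by apply/ext_exact; exists n.
have ab n : b (ext_inj E n) = ext_inj F (a n) by rewrite aE rE.
by exists (ExtHom ab bc).
Qed.

(** If [hom_alg h a] and [b] have the same class, they differ by an element of
    the kernel of [F]. *)
Lemma hom_alg_cocentral E F (h : ext_hom E F) :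
  bijective (hom_quo h) -> forall b, exists a, is_central (b - hom_alg h a).
Proof.
move=> /bij_surj hsurj b; have [q hq] := hsurj (ext_proj F b).
have [a aq] := ext_proj_surj q; exists a; apply: ext_ker_central.
by rewrite linearB /= -hom_proj_comm aq hq subrr.
Qed.

(** By linearity the map [beta'] of an isoclinic homomorphism can only be the
    restriction of [hom_alg h] to the commutator ideals, and this restriction
    is automatically onto when [hom_quo h] is. *)
Lemma isoclinic_homP E F (h : ext_hom E F) :
  isoclinic_hom h <->
  bijective (hom_quo h) /\
  {in awb_commutator (ext_alg E), forall x, hom_alg h x = 0 -> x = 0}.
Proof.
have [r rE] := commutator_restrict (hom_alg h).
split=> [[xi [hb xb xC xP]]|[hb hinj]].
  have xir : xi =1 r.
    apply: commutator_linear_eq => a b; apply: val_inj; rewrite rE /=.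
      by rewrite -ext_PE xP !hom_proj_comm ext_PE awbhomM.
    by rewrite -ext_CE xC !hom_proj_comm ext_CE awbhomB.
  split=> // x Cx hx0; suff : exist _ x Cx = 0 :> subawb (awb_commutator (ext_alg E)).
    by move/(congr1 val).
  by apply: (bij_inj xb); rewrite xir linear0; apply: val_inj; rewrite rE.
exists r; split=> //.
- exact: (commutator_restrict_bij rE (hom_alg_cocentral hb) hinj).
- move=> p q; have [g <-] := ext_proj_surj p; have [k <-] := ext_proj_surj q.
  by rewrite !hom_proj_comm !ext_CE; apply: val_inj; rewrite rE /= awbhomB.
- move=> p q; have [g <-] := ext_proj_surj p; have [k <-] := ext_proj_surj q.
  by rewrite !hom_proj_comm !ext_PE; apply: val_inj; rewrite rE /= awbhomM.
Qed.

Lemma isoclinic_hom_ext E F (h : ext_hom E F) :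
  isoclinic_hom h -> ext_isoclinic E F.
Proof. by move=> [xi ?]; exists (hom_quo h), xi. Qed.

(** The inclusion of a subalgebra that together with the center spans [B], and
    the projection modulo an ideal that meets the commutator ideal trivially,
    are both of this form.  An element [a] is central as soon as [f a] is,
    since the products and brackets of [a] lie in the commutator ideal, where
    [f] is injective; so [f] induces an injection on the quotients by the
    centers. *)
Lemma cocentral_awb_isoclinic A B (f : {awb A -> B}) :
    (forall b, exists a, is_central (b - f a)) ->
    {in awb_commutator A, forall x, f x = 0 -> x = 0} ->
  awb_isoclinic A B.
Proof.
move=> fsurj finj.
have fZ a : is_central (f a) <-> is_central a.
  split=> Za b.
    by have [] := Za (f b); split; apply: finj;
      rewrite ?amul_commutator ?abr_commutator // (awbhomM, awbhomB).
  have [b' Zb] := fsurj b.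
  have Z0 : is_central (f a - f a).
    by rewrite subrr => c; rewrite amul0l amul0r abr0l abr0r.
  rewrite (central_diffM Z0 Zb) (central_diffM Zb Z0).
  rewrite (central_diffB Z0 Zb) (central_diffB Zb Z0).
  by rewrite -!awbhomM -!awbhomB; have [-> -> -> ->] := Za b'; rewrite linear0.
have piE (C : awbType K) (c : C) : (quotawb_pi (awb_center C) c = 0) <-> is_central c.
  rewrite -(linear0 (quotawb_pi (awb_center C))) quotawb_piE subr0.
  by split=> /awb_centerP.
have [r rE] := awb_comp (quotawb_pi (awb_center B)) f.
have rE0 a : r a = 0 <-> is_central a by rewrite rE piE fZ.
have [a /piE/rE0//|e eE] :=
  @awb_factor _ _ _ _ (quotawb_pi (awb_center A)) r (@quotawb_pi_surj _ _ _).
have [|h [hf he]] := @ext_hom_exists (center_ext A) (center_ext B) f e.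
  by move=> a /=; rewrite eE rE.
apply: (@isoclinic_hom_ext _ _ h); apply/isoclinic_homP; rewrite hf he.
split=> //; apply: bij_of_inj_surj => [|q].
  by apply: awb_inj => q; have [a <-] := quotawb_pi_surj q; rewrite eE => /rE0/piE.
have [b <-] := quotawb_pi_surj q; have [a Zb] := fsurj b.
exists (quotawb_pi (awb_center A) a); rewrite eE rE /=; apply/esym/quotawb_piE.
exact/awb_centerP.
Qed.

(** Isoclinism of extensions thus descends to their algebras, although the
    kernels may be smaller than the centers. *)
Lemma isoclinic_hom_awb E F (h : ext_hom E F) :
  isoclinic_hom h -> awb_isoclinic (ext_alg E) (ext_alg F).
Proof.
move=> /isoclinic_homP[hb hinj].
exact: (cocentral_awb_isoclinic (hom_alg_cocentral hb) hinj).
Qed.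

Lemma isomorphic_isoclinic A B : awb_isomorphic A B -> awb_isoclinic A B.
Proof.
move=> [f fb]; apply: (@cocentral_awb_isoclinic A B f) => [b|x _ fx0].
  have [a <-] := bij_surj fb b; exists a => c.
  by rewrite subrr amul0l amul0r abr0l abr0r.
by apply: (bij_inj fb); rewrite fx0 linear0.
Qed.

(** * Isoclinisms of algebras over a field come from homomorphisms *)

(** An arbitrary linear lift of [eta] away from the commutator ideal works,
    because products and brackets depend only on classes in the quotient and
    take values in the commutator ideal. *)
Lemma isoclinism_hom E F :
  ext_isoclinic E F -> exists h : ext_hom E F, isoclinic_hom h.
Proof.
move=> [eta [xi [etab xib xiC xiP]]].
have [p [pW p0]] := linear_retraction (awb_commutator (ext_alg E)).
(* t is constant on the fibres of ext_proj F: it factors through a linear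
   section s. *)
have [t [tW t0]] := linear_retraction (awb_ker (ext_proj F)).
have [g /eqP g0|s sE] := @linear_factor _ _ _ _ (ext_proj F) t (@ext_proj_surj _ F).
  exact: t0.
have sK q : ext_proj F (s q) = q.
  have [g <-] := ext_proj_surj q; rewrite sE; apply/esym/eqP.
  by rewrite -subr_eq0 -linearB -awb_kerE.
pose c g : subawb (awb_commutator (ext_alg E)) := exist _ (g - p g) (pW g).
have cL k x y : c (k *: x + y) = k *: c x + c y.
  by apply: val_inj; rewrite /= linearP opprD addrACA -scalerBr.
have p_val (x : subawb (awb_commutator (ext_alg E))) : p (val x) = 0.
  by apply: p0; apply: valP.
have cK x : c (val x) = x.
  by apply: val_inj; rewrite /= p0 ?subr0 //; apply: valP.
(* This compatibility lets b be a lift of eta also on the commutator ideal. *)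
have xi_eta x : ext_proj F (val (xi x)) = eta (ext_proj E (val x)).
  move: x; apply: commutator_ind => [|k x y IHx IHy|a b|a b].
  - by rewrite !linear0.
  - by rewrite !linearP /= -IHx -IHy.
  - have [a' aE] := ext_proj_surj (eta (ext_proj E a)).
    have [b' bE] := ext_proj_surj (eta (ext_proj E b)).
    by rewrite -ext_PE xiP -aE -bE ext_PE /= !awbhomM aE bE !ext_liftK.
  - have [a' aE] := ext_proj_surj (eta (ext_proj E a)).
    have [b' bE] := ext_proj_surj (eta (ext_proj E b)).
    by rewrite -ext_CE xiC -aE -bE ext_CE /= !awbhomB aE bE !ext_liftK.
pose b g := val (xi (c g)) + s (eta (ext_proj E (p g))).
have b_val x : b (val x) = val (xi x).
  by rewrite /b cK p_val !linear0 addr0.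
have b_eta g : ext_proj F (b g) = eta (ext_proj E g).
  by rewrite linearD /= sK xi_eta -linearD -linearD subrK.
have [k x y|x y|x y|f fE] := @awb_hom_of K (ext_alg E) (ext_alg F) b.
- by rewrite /b cL !linearP /= scalerDr addrACA.
- rewrite -[x *a y]/(val (commutator_mul x y)) b_val -ext_PE xiP -!b_eta.
  by rewrite ext_PE.
- rewrite -[ [: x, y :] ]/(val (commutator_br x y)) b_val -ext_CE xiC -!b_eta.
  by rewrite ext_CE.
have [g|h [hf he]] := @ext_hom_exists E F f eta; first by rewrite fE b_eta.
exists h; apply/isoclinic_homP; rewrite hf he; split=> // x Cx.
rewrite fE -[x]/(val (exist _ x Cx : subawb (awb_commutator (ext_alg E)))) b_val => x0.
suff -> : exist _ x Cx = 0 :> subawb (awb_commutator (ext_alg E)) by [].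
by apply: (bij_inj xib); rewrite linear0; apply: val_inj.
Qed.

End IsoclinicHoms.

(** * Enlarging an extension by an abelian factor *)

Section AbelianFactor.
Variables (K : fieldType) (A : awbType K) (V : lmodType K).

(** The direct product of [A] with [V], where [V] has zero product and
    bracket; the alias hides any other structure on the pairs. *)
Definition abprod : Type := (A * V)%type.
HB.instance Definition _ := GRing.Lmodule.copy abprod (A * V)%type.

Definition abprod_mul (x y : abprod) : abprod := (x.1 *a y.1, 0).
Definition abprod_br (x y : abprod) : abprod := ([: x.1, y.1 :], 0).

Fact abprod_mul_bilinear : bilinear_for *:%R *:%R abprod_mul.
Proof.
by split=> u k x y; congr pair; rewrite /= ?scaler0 ?addr0 // ?amulZDl ?amulZDr.
Qed.
Fact abprod_br_bilinear : bilinear_for *:%R *:%R abprod_br.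
Proof.
by split=> u k x y; congr pair; rewrite /= ?scaler0 ?addr0 // ?abrZDl ?abrZDr.
Qed.
Fact abprod_mulA : associative abprod_mul.
Proof. by move=> x y z; rewrite /abprod_mul /= amulA. Qed.
Fact abprod_br_mul x y z :
  abprod_br (abprod_mul x y) z =
  abprod_mul (abprod_br x z) y + abprod_mul x (abprod_br y z).
Proof. by congr pair; rewrite /= ?addr0 ?abr_amul. Qed.
HB.instance Definition _ := Lmodule_isAWB.Build K abprod
  abprod_mul_bilinear abprod_br_bilinear abprod_mulA abprod_br_mul.

Lemma abprod_commutator (x : abprod) :
  x \in awb_commutator abprod -> x.1 \in awb_commutator A /\ x.2 = 0.
Proof.
move: x; apply: commutator_sub => [|k x y [x1 x2] [y1 y2]|a b|a b].
- by split=> //; apply: rpred0.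
- by split; rewrite /= ?x2 ?y2 ?scaler0 ?addr0 // rpredD ?rpredZ.
- by split=> //; apply: amul_commutator.
- by split=> //; apply: abr_commutator.
Qed.

End AbelianFactor.

Section KernelExt.
Variables (K : fieldType) (G Q : awbType K) (p : {awb G -> Q}).

Fact kernel_ext_exact g : p g = 0 <-> exists n, subawb_val (awb_ker p) n = g.
Proof.
split=> [/eqP pg | [n <-]]; first by exists (exist _ g pg).
exact/eqP/(valP n).
Qed.

Fact kernel_ext_central (pZ : forall g, p g = 0 -> is_central g) n :
  subawb_val (awb_ker p) n \in awb_center G.
Proof. exact/awb_centerP/pZ/eqP/(valP n). Qed.

Definition kernel_ext (p_surj : forall q, exists g, p g = q)
    (pZ : forall g, p g = 0 -> is_central g) : central_ext K :=
  CentralExt (@subawb_val_inj K G (awb_ker p)) kernel_ext_exact p_surj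
    (kernel_ext_central pZ).

End KernelExt.

Section AbelianFactorExt.
Variables (K : fieldType) (E : central_ext K) (V : lmodType K).

Definition abprod_proj (x : abprod (ext_alg E) V) : ext_quo E := ext_proj E x.1.

Fact abprod_proj_linear : linear abprod_proj.
Proof. by move=> k x y; rewrite /abprod_proj linearP. Qed.
HB.instance Definition _ := GRing.isLinear.Build K (abprod (ext_alg E) V)
  (ext_quo E) *:%R abprod_proj abprod_proj_linear.
HB.instance Definition _ := isAWBHom.Build K (abprod (ext_alg E) V) (ext_quo E)
  abprod_proj (fun x y => awbhomM x.1 y.1) (fun x y => awbhomB x.1 y.1).

Fact abprod_proj_surj q : exists x, abprod_proj x = q.
Proof. by have [g <-] := ext_proj_surj q; exists (g, 0). Qed.

Fact abprod_proj_central x : abprod_proj x = 0 -> is_central x.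
Proof.
move=> /ext_ker_central Zx y; have [x1 x2 x3 x4] := Zx y.1.
by split; congr pair.
Qed.

(** The central extension with kernel [N * V] and the same quotient as [E]. *)
Definition abprod_ext : central_ext K :=
  kernel_ext abprod_proj_surj abprod_proj_central.

End AbelianFactorExt.

Section AbelianFactorHoms.
Variables (K : fieldType) (E F : central_ext K).

Lemma abprod_ext_fst (V : lmodType K) :
  exists h : ext_hom (abprod_ext E V) E, isoclinic_epi h.
Proof.
have [|//|//|f fE] := @awb_hom_of K (abprod (ext_alg E) V) (ext_alg E) fst.
  by [].
have [c cE] := awb_id (ext_quo E).
have [g|h [hf hc]] := @ext_hom_exists K (abprod_ext E V) E f c.
  by rewrite cE fE.
exists h; split=> [|g]; last by exists (g, 0); rewrite hf fE.
apply/isoclinic_homP; rewrite hf hc; split; first by exists id => x; rewrite cE.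
by move=> [x v] /abprod_commutator[/= _ ->]; rewrite fE /= => ->.
Qed.

Lemma abprod_ext_in (V : lmodType K) :
  exists h : ext_hom E (abprod_ext E V), isoclinic_mono h.
Proof.
pose i g : abprod (ext_alg E) V := (g, 0).
have [k x y|x y|x y|f fE] := @awb_hom_of K (ext_alg E) (abprod (ext_alg E) V) i.
- by congr pair; rewrite /= scaler0 addr0.
- by [].
- by [].
have [c cE] := awb_id (ext_quo E).
have [g|h [hf hc]] := @ext_hom_exists K E (abprod_ext E V) f c.
  by rewrite cE fE.
have finj : injective f by move=> x y; rewrite !fE => -[].
exists h; split; last by rewrite hf.
apply/isoclinic_homP; rewrite hf hc; split; first by exists id => x; rewrite cE.
by move=> x _; rewrite -(linear0 f) => /finj.
Qed.

(** The kernel of [F] is what the image of [h] may lack: adding it as an abelian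
    factor makes [h] surjective. *)
Lemma abprod_ext_epi (h : ext_hom E F) : isoclinic_hom h ->
  exists h' : ext_hom (abprod_ext E (ext_ker F)) F, isoclinic_epi h'.
Proof.
move=> /isoclinic_homP[hb hinj].
pose b (x : abprod (ext_alg E) (ext_ker F)) := hom_alg h x.1 + ext_inj F x.2.
have Z n : is_central (ext_inj F n) by apply/awb_centerP/ext_central.
have bZ x : is_central (b x - hom_alg h x.1) by rewrite /b addrC addKr.
have [k x y|x y|x y|f fE] :=
  @awb_hom_of K (abprod (ext_alg E) (ext_ker F)) (ext_alg F) b.
- by rewrite /b /= !linearP /= scalerDr addrACA.
- by rewrite (central_diffM (bZ x) (bZ y)) /b /= linear0 addr0 awbhomM.
- by rewrite (central_diffB (bZ x) (bZ y)) /b /= linear0 addr0 awbhomB.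
have projK n : ext_proj F (ext_inj F n) = 0 by apply/ext_exact; exists n.
have [g|h' [hf hc]] :=
  @ext_hom_exists K (abprod_ext E (ext_ker F)) F f (hom_quo h).
  by rewrite fE linearD /= projK addr0 -hom_proj_comm.
exists h'; split=> [|g].
  apply/isoclinic_homP; rewrite hf hc; split=> // -[x n].
  move=> /abprod_commutator[/= Cx ->]; rewrite fE /b /= linear0 addr0 => x0.
  by rewrite (hinj x).
have [q hq] := bij_surj hb (ext_proj F g); have [a aq] := ext_proj_surj q.
have /ext_exact[n ng] : ext_proj F (g - hom_alg h a) = 0.
  by rewrite linearB /= -hom_proj_comm aq hq subrr.
by exists (a, n); rewrite hf fE /b /= ng addrC subrK.
Qed.

(** The added coordinate is a projection whose kernel is the commutator ideal,
    on which [h] is injective. *)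
Lemma abprod_ext_mono (h : ext_hom E F) : isoclinic_hom h ->
  exists h' : ext_hom E (abprod_ext F (ext_alg E)), isoclinic_mono h'.
Proof.
move=> /isoclinic_homP[hb hinj].
have [p [pW p0]] := linear_retraction (awb_commutator (ext_alg E)).
pose b x : abprod (ext_alg F) (ext_alg E) := (hom_alg h x, p x).
have [k x y|x y|x y|f fE] :=
  @awb_hom_of K (ext_alg E) (abprod (ext_alg F) (ext_alg E)) b.
- by rewrite /b !linearP.
- by rewrite /b p0 ?amul_commutator // awbhomM.
- by rewrite /b p0 ?abr_commutator // awbhomB.
have finj : injective f.
  apply: awb_inj => x; rewrite fE => -[hx0 px0]; apply: hinj => //.
  by rewrite -[x]subr0 -px0.
have [g|h' [hf hc]] :=
  @ext_hom_exists K E (abprod_ext F (ext_alg E)) f (hom_quo h).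
  by rewrite fE hom_proj_comm.
exists h'; split; last by rewrite hf.
apply/isoclinic_homP; rewrite hf hc; split=> // x _.
by rewrite -(linear0 f) => /finj.
Qed.

End AbelianFactorHoms.

(** * The equivalence *)

Section Quotients.
Variables (K : fieldType) (E F : central_ext K) (h : ext_hom E F).

Lemma isoclinic_epi_quot : isoclinic_epi h ->
  awb_isomorphic (quotawb (awb_ker (hom_alg h))) (ext_alg F) /\
  awb_isoclinic (ext_alg E) (quotawb (awb_ker (hom_alg h))).
Proof.
move=> [hi hs]; have hq := first_isomorphism hs; split=> //.
apply: ext_isoclinic_trans (isoclinic_hom_awb hi) _.
exact/isomorphic_isoclinic/awb_isomorphic_sym.
Qed.

Lemma isoclinic_mono_sub : isoclinic_mono h ->
  awb_isomorphic (ext_alg E) (subawb (awb_img (hom_alg h))) /\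
  awb_isoclinic (subawb (awb_img (hom_alg h))) (ext_alg F).
Proof.
move=> [hi hj]; have hs := injective_isomorphism hj; split=> //.
apply: ext_isoclinic_trans (isoclinic_hom_awb hi).
exact/isomorphic_isoclinic/awb_isomorphic_sym.
Qed.

End Quotients.

Theorem proposition3p12 (K : fieldType) (G1 G2 : central_ext K) :
  [/\ [<-> ext_isoclinic G1 G2;
           exists (G' : central_ext K) (h1 : ext_hom G' G1) (h2 : ext_hom G' G2),
             isoclinic_epi h1 /\ isoclinic_epi h2;
           exists (G'' : central_ext K) (h1 : ext_hom G1 G'') (h2 : ext_hom G2 G''),
             isoclinic_mono h1 /\ isoclinic_mono h2],
      (forall (G' : central_ext K) (h1 : ext_hom G' G1) (h2 : ext_hom G' G2),
         isoclinic_epi h1 -> isoclinic_epi h2 ->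
         exists I1 I2 : idealAWB (ext_alg G'),
           [/\ awb_isomorphic (ext_alg G1) (quotawb I1),
               awb_isoclinic (quotawb I1) (ext_alg G'),
               awb_isoclinic (ext_alg G') (quotawb I2) &
               awb_isomorphic (quotawb I2) (ext_alg G2)])
    & (forall (G'' : central_ext K) (h1 : ext_hom G1 G'') (h2 : ext_hom G2 G''),
         isoclinic_mono h1 -> isoclinic_mono h2 ->
         exists S1 S2 : subAWB (ext_alg G''),
           [/\ awb_isomorphic (ext_alg G1) (subawb S1),
               awb_isoclinic (subawb S1) (ext_alg G''),
               awb_isoclinic (ext_alg G'') (subawb S2) &
               awb_isomorphic (subawb S2) (ext_alg G2)])].
Proof.
split.
- tfae.
  + move=> /isoclinism_hom[h hi]; exists (abprod_ext G1 (ext_ker G2)).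
    have [h1 ?] := abprod_ext_fst G1 (ext_ker G2).
    by have [h2 ?] := abprod_ext_epi hi; exists h1, h2.
  + move=> [G' [h1 [h2 [[/isoclinic_hom_ext i1 _] [/isoclinic_hom_ext i2 _]]]]].
    have [h hi] := isoclinism_hom (ext_isoclinic_trans (ext_isoclinic_sym i1) i2).
    exists (abprod_ext G2 (ext_alg G1)).
    have [k1 ?] := abprod_ext_mono hi.
    by have [k2 ?] := abprod_ext_in G2 (ext_alg G1); exists k1, k2.
  + move=> [G'' [h1 [h2 [[/isoclinic_hom_ext i1 _] [/isoclinic_hom_ext i2 _]]]]].
    exact: ext_isoclinic_trans i1 (ext_isoclinic_sym i2).
- move=> G' h1 h2 /isoclinic_epi_quot[q1 i1] /isoclinic_epi_quot[q2 i2].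
  exists (awb_ker (hom_alg h1)), (awb_ker (hom_alg h2)); split=> //.
    exact: awb_isomorphic_sym.
  exact: ext_isoclinic_sym.
- move=> G'' h1 h2 /isoclinic_mono_sub[s1 i1] /isoclinic_mono_sub[s2 i2].
  exists (awb_img (hom_alg h1)), (awb_img (hom_alg h2)); split=> //.
    exact: ext_isoclinic_sym.
  exact: awb_isomorphic_sym.
Qed.
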